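(* For an integer $N\geq 2$, let $\ell_N$ denote the length of the longest run of consecutive positive integers, all smaller than $N$, which all have the same number of positive divisors. Then there exist constants $C>0$ and $N_0$ such that for all $N\geq N_0$, \[\log \ell_N \leq C\sqrt[3]{\log N\cdot\log\log N}.\]
   Context: A run of consecutive integers means a set $\{n+1,n+2,\ldots,n+k\}$ of positive integers; it has the property in question if $d(n+1)=d(n+2)=\cdots=d(n+k)$, where $d(m)$ denotes the number of positive divisors of $m$. $\log$ is the natural logarithm. *)

(* Defs.v *)
From mathcomp Require Import all_boot all_order all_algebra.

Set Implicit Arguments.
Unset Strict Implicit.
Unset Printing Implicit Defensive.

Definition num_divisors (m : nat) : nat := size (divisors m).

(* d(n+1) = d(n+2) = ... = d(n+k); the index i : 'I_k stands for n + i + 1. *)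
Definition equidivisor_run (n k : nat) : bool :=
  [forall i : 'I_k, forall j : 'I_k,
     num_divisors (n + i.+1) == num_divisors (n + j.+1)].

(* The length of the longest run {n+1, ..., n+k}, n >= 0, with all elements
   < N.  The bounds k < N and n < N lose nothing, since n + k < N. *)
Definition longest_run (N : nat) : nat :=
  \max_(k < N | [exists n : 'I_N, (n + k < N) && equidivisor_run n k]) k.

Lemma equidivisor_runP (n k : nat) :
  reflect (forall i j, 0 < i <= k -> 0 < j <= k ->
             num_divisors (n + i) = num_divisors (n + j))
          (equidivisor_run n k).
Proof.
apply: (iffP idP) => [/forallP H [|i] [|j] //= ik jk | H].
  by have /forallP/(_ (Ordinal jk))/eqP := H (Ordinal ik).
by apply/forallP => i; apply/forallP => j; apply/eqP/H; rewrite /= ltn_ord.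
Qed.

Lemma leq_longest_run (N n k : nat) :
  n + k < N -> equidivisor_run n k -> k <= longest_run N.
Proof.
move=> nkN run.
have kN : k < N by apply: leq_ltn_trans nkN; rewrite leq_addl.
have nN : n < N by apply: leq_ltn_trans nkN; rewrite leq_addr.
rewrite /longest_run -[k]/(val (Ordinal kN)).
apply: (@leq_bigmax_cond _ _ (fun i : 'I_N => val i)).
by apply/existsP; exists (Ordinal nN); rewrite /= nkN.
Qed.

Lemma longest_run_attained (N : nat) : 1 < N ->
  exists n, [/\ 0 < longest_run N, n + longest_run N < N
              & equidivisor_run n (longest_run N)].
Proof.
move=> N1.
have run1 : equidivisor_run 0 1.
  by apply/forallP => i; apply/forallP => j; rewrite !ord1.
have card_gt0 :
    0 < #|[pred k : 'I_N |
           [exists n : 'I_N, (n + k < N) && equidivisor_run n k]]|.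
  apply/card_gt0P; exists (Ordinal N1); apply/existsP.
  by exists (Ordinal (ltnW N1)); rewrite /= N1.
have pos : 0 < longest_run N by apply: leq_longest_run run1.
have [k /existsP [n /andP [nk run]] E] :=
  eq_bigmax_cond (fun i : 'I_N => val i) card_gt0.
have {}E : longest_run N = k by rewrite -E; apply: eq_bigl.
by exists n; rewrite E; split => //; rewrite -E.
Qed.

(* Main.v *)
Require Import Defs.
From mathcomp Require Import all_boot all_order all_algebra zify lra.
From mathcomp Require Import reals exp.

Set Implicit Arguments.
Unset Strict Implicit.

(* Let k be the length of a run with common divisor count D, and L = log2 k.
   For q <= L the run contains an element divisible by 2^(q-1) exactly, so
   every q <= L divides D.  By a union bound some element m of the run is
   divisible by no cube p^3 with p <= k/4.  For each prime 3 < q <= L, q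
   divides D = d(m), hence q divides e_p + 1 for some exponent e_p of m; as
   then e_p >= 3, the prime p exceeds k/4.  Therefore the exponents of primes
   above k/4 in m add up to at least half the sum of the primes 3 < q <= L,
   which is >> L^2 / log L by Chebyshev's estimates, and
   log N >= log m >> L^2 / log L * log k >> L^3 / log L. *)

(** * Divisor counts along a run *)

Lemma num_divisorsE m :
  num_divisors m = \prod_(p <- primes m) (logn p m).+1.
Proof.
rewrite /num_divisors /divisors prime_decompE.
elim: (primes m) => [|p s IH] /=; first by rewrite big_nil.
rewrite big_cons -IH; move: (foldr _ _ _) => ds.
elim: (logn p m) => [|e IHe]; rewrite ?mul1n //=.
by rewrite size_merge size_cat size_map IHe addnC mulSn.
Qed.

Lemma logn_succ_dvd_num_divisors p m : (logn p m).+1 %| num_divisors m.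
Proof.
rewrite num_divisorsE; have [pm|] := boolP (p \in primes m).
  by rewrite (big_rem _ pm) dvdn_mulr.
by rewrite -logn_gt0 -eqn0Ngt => /eqP ->.
Qed.

Lemma dvdn_num_divisors_run n k q i :
  equidivisor_run n k -> 0 < q -> 2 ^ q <= k -> 0 < i <= k ->
  q %| num_divisors (n + i).
Proof.
move=> /equidivisor_runP run; case: q => // q _ qk ik.
(* [q] is now the predecessor of the original one. The multiple of 2^(q+1) keeps the subtraction
   from truncating, so [r] represents 2^q - (n+1) modulo 2^(q+1). *)
pose r := 2 ^ q + (2 ^ q.+1 * n.+1 - n.+1).
have q2 : 0 < 2 ^ q by rewrite expn_gt0.
have E : 2 ^ q.+1 = 2 ^ q * 2 by rewrite expnSr.
(* n + j is congruent to 2^q modulo 2^(q+1) *)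
pose j := (r %% 2 ^ q.+1).+1.
have jk : 0 < j <= k by apply: leq_trans qk; rewrite /j ltn_pmod // expn_gt0.
rewrite (run i j ik jk).
have dv : exists t, n + j = 2 ^ q * t.*2.+1.
  have H := divn_eq r (2 ^ q.+1).
  have Hj : j = (r %% 2 ^ q.+1).+1 by [].
  have rE : r + n.+1 = 2 ^ q + 2 ^ q.+1 * n.+1.
    by rewrite /r -addnA subnK // leq_pmull // expn_gt0.
  exists (n.+1 - r %/ 2 ^ q.+1).
  have le : r %/ 2 ^ q.+1 <= n.+1.
    rewrite -ltnS ltn_divLR ?expn_gt0 //.
    have : r < 2 ^ q.+1 + 2 ^ q.+1 * n.+1 by lia.
    by rewrite -mulnS mulnC.
  move: (r %/ 2 ^ q.+1) le H => u le H.
  move: rE; rewrite -{2}(subnKC le) E => rE.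
  by rewrite E in H Hj; nia.
have [t ->] := dv.
suff lq : logn 2 (2 ^ q * t.*2.+1) = q.
  by rewrite -{1}lq logn_succ_dvd_num_divisors.
rewrite lognM // pfactorK // [logn 2 _.+1]logn_coprime ?addn0 //.
by rewrite coprime2n /= odd_double.
Qed.

(** * Prime divisors of exponents plus one *)

Lemma prod_primes_dvd (s : seq nat) (P : pred nat) x :
  uniq s -> (forall p, p \in s -> P p -> prime p && (p %| x)) ->
  \prod_(p <- s | P p) p %| x.
Proof.
elim: s => [|p s IH] /=; first by rewrite big_nil dvd1n.
move=> /andP[ps us] H; rewrite big_cons.
have {}IH : \prod_(p <- s | P p) p %| x.
  by apply: IH => // q qs; apply: H; rewrite inE qs orbT.
case: ifP => // Pp.
have /andP[pp px] := H p (mem_head _ _) Pp.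
rewrite Gauss_dvd ?px //= prime_coprime // big_seq_cond Euclid_dvd_prod //.
rewrite big_has_cond; apply/hasPn => q qs; apply/negP => /= /andP[/andP[_ Pq]].
have qin : q \in p :: s by rewrite inE qs orbT.
have /andP[qp _] := H q qin Pq.
by rewrite dvdn_prime2 // => /eqP pq; rewrite pq qs in ps.
Qed.

Lemma sum_le_prod_gt1 (s : seq nat) (P : pred nat) :
  (forall p, p \in s -> P p -> 1 < p) ->
  \sum_(p <- s | P p) p <= \prod_(p <- s | P p) p.
Proof.
move=> H.
(* The induction uses a + b <= a b for a, b >= 2; the empty selection, with sum 0 and product 1,
   must be split off. *)
suff : \sum_(p <- s | P p) p = 0 \/
    1 < \sum_(p <- s | P p) p <= \prod_(p <- s | P p) p.
  by case=> [->|/andP[]].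
elim: s H => [|p s IH] H; first by rewrite !big_nil; left.
have {}IH := IH (fun q qs => H q (@mem_behead _ (p :: s) q qs)).
rewrite !big_cons; case: (boolP (P p)) => // Pp; right.
have p1 := H p (mem_head _ _) Pp.
have : 0 < \prod_(i <- s | P i) i.
  rewrite big_seq_cond prodn_cond_gt0 // => q /andP[qs Pq].
  by apply: ltnW; apply: H => //; rewrite inE qs orbT.
by case: IH => [->|]; nia.
Qed.

(* Distinct primes dividing f have product at most f, and a product of
   integers >= 2 dominates their sum. *)
Lemma sum_prime_divisors_le (s : seq nat) f :
  uniq s -> {in s, forall q, prime q} -> 0 < f ->
  \sum_(q <- s | q %| f) q <= f.
Proof.
move=> us ps f0; apply: leq_trans (dvdn_leq f0 _).
  by apply: sum_le_prod_gt1 => p /ps /prime_gt1.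
by apply: prod_primes_dvd => // p /ps ->.
Qed.

(** Charge each q to the primes p with q | e_p + 1, where e_p = [logn p m]. The q charged to one p
    sum to at most e_p + 1 <= 2 e_p; this doubling causes the square of m. *)
Lemma exp_sum_le_sqr (Q : seq nat) m y :
  uniq Q -> {in Q, forall q, prime q && (3 < q)} -> 0 < m ->
  {in Q, forall q, q %| num_divisors m} ->
  (forall p, prime p -> p <= y -> ~~ (p ^ 3 %| m)) ->
  y ^ (\sum_(q <- Q) q) <= m ^ 2.
Proof.
move=> uQ pQ m0 dQ small.
have [->|y0] := posnP y.
  by case: (\sum_(q <- Q) q) => [|s]; rewrite ?expn0 ?expn_gt0 ?m0 // exp0n.
have big p q : p \in primes m -> q \in Q -> q %| (logn p m).+1 -> y < p.
  move=> pm qQ /(dvdn_leq (ltn0Sn _)) qle; rewrite ltnNge; apply/negP => py.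
  have pp : prime p by move: pm; rewrite mem_primes => /andP[].
  have /andP[_ q3] := pQ _ qQ.
  have /negP[] := small p pp py; rewrite pfactor_dvdn //.
  by rewrite -ltnS (leq_trans q3).
have -> : m ^ 2 = \prod_(p <- primes m) p ^ (logn p m).*2.
  rewrite {1}(prod_prime_decomp m0) prime_decompE big_map /=.
  rewrite (big_morph (expn^~ 2) (fun a b => expnMn a b 2) (exp1n 2)).
  by apply: eq_bigr => p _; rewrite -expnM muln2.
apply: (@leq_trans (\prod_(p <- primes m) y ^ (\sum_(q <- Q | q %| (logn p m).+1) q))).
  rewrite -expn_sum; apply: leq_pexp2l => //.
  (* After the exchange, each q must occur for at least one p: being prime, it divides some factor
     e_p + 1 of d(m). *)
  rewrite (exchange_big_dep xpredT) //=.
  rewrite big_seq [X in _ <= X]big_seq; apply: leq_sum => q qQ.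
  have /andP[qp _] := pQ _ qQ.
  have := dQ _ qQ; rewrite num_divisorsE Euclid_dvd_prod // big_has => /hasP[p pm qd].
  by rewrite (big_rem _ pm) /= qd leq_addr.
rewrite big_seq [X in _ <= X]big_seq; apply: leq_prod => p pm.
have lp : 0 < logn p m by rewrite logn_gt0.
have [/hasP[q qQ qd]|/hasPn no] := boolP (has (fun q => q %| (logn p m).+1) Q); last first.
  rewrite big_seq_cond big1 ?expn0 ?expn_gt0.
    by rewrite (prime_gt0 _) //; move: pm; rewrite mem_primes => /andP[].
  by move=> q /andP[/no /negbTE ->].
apply: leq_trans (_ : y ^ (logn p m).*2 <= _); last first.
  by rewrite leq_exp2r ?double_gt0 // ltnW // (big p q).
apply: leq_pexp2l => //.
apply: (@leq_trans (logn p m).+1); last by lia.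
by apply: sum_prime_divisors_le => // r /pQ /andP[].
Qed.

(** * Chebyshev's estimates from central binomial coefficients *)

Lemma prime_dvd_central_bin m p : prime p -> m < p <= m.*2 -> p %| 'C(m.*2, m).
Proof.
move=> pp /andP[mp pm].
have : p %| m.*2`! by rewrite dvdn_fact // prime_gt0.
rewrite -(@bin_fact m.*2 m) -?addnn ?leq_addr // addnK !Euclid_dvdM //.
suff /negbTE -> : ~~ (p %| m`!) by rewrite !orbF.
rewrite fact_prod big_nat Euclid_dvd_prod // big_has_cond; apply/hasPn => i _ /=.
by apply/negP => /andP[/andP[i0 im] /(dvdn_leq i0)]; lia.
Qed.

(** Doubling m multiplies the product by the primes in (m, 2m], whose product divides C(2m, m) <=
    4^m. *)
Lemma prod_primes_le_exp4 a :
  \prod_(1 <= p < (2 ^ a).+1 | prime p) p <= 4 ^ (2 ^ a).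
Proof.
elim: a => [|a IH]; first by rewrite expn0 big_mkcond big_nat1.
set m := 2 ^ a in IH *.
have m0 : 0 < m by rewrite expn_gt0.
have -> : 2 ^ a.+1 = m.*2 by rewrite expnS mul2n.
rewrite (@big_cat_nat _ _ _ m.+1) //=; last by lia.
rewrite -addnn expnD; apply: leq_mul => //.
apply: (@leq_trans 'C(m.*2, m)).
  apply: dvdn_leq; first by rewrite bin_gt0 -addnn leq_addr.
  apply: prod_primes_dvd; first exact: iota_uniq.
  move=> p; rewrite mem_index_iota => pm pp; rewrite pp prime_dvd_central_bin //.
  by lia.
have -> : 4 ^ m = 2 ^ m.*2 by rewrite -mul2n expnM.
rewrite -[2]/(1 + 1) expnDn (bigD1 (inord m)) //= !exp1n !muln1 inordK ?leq_addr //.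
lia.
Qed.

(** By Legendre's formula the exponent is the sum over k of floor(2n/p^k) - 2 floor(n/p^k). Each
    term is at most 1 and vanishes once p^k > 2n. *)
Lemma pfactor_central_bin_le p n :
  prime p -> 0 < n -> p ^ logn p 'C(n.*2, n) <= n.*2.
Proof.
move=> pp n0; set v := logn _ _.
have E : logn p n.*2`! = v + (logn p n`!).*2.
  rewrite -(@bin_fact n.*2 n) -?addnn ?leq_addr // addnK !lognM ?muln_gt0 ?fact_gt0 ?bin_gt0 ?leq_addr //.
  by rewrite addnn.
rewrite !logn_fact // in E.
suff vle : v <= trunc_log p n.*2.
  apply: leq_trans (trunc_logP (prime_gt1 pp) _); last by rewrite double_gt0.
  by rewrite leq_pexp2l // prime_gt0.
set t := trunc_log _ _.
have tn : t <= n.*2.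
  have := trunc_logP (prime_gt1 pp) (_ : 0 < n.*2); rewrite double_gt0 => /(_ n0).
  by apply: leq_trans; apply: ltnW; rewrite ltn_expl // prime_gt1.
have big k : t < k -> n.*2 %/ p ^ k = 0.
  move=> tk; rewrite divn_small // (leq_trans (trunc_log_ltn _ (prime_gt1 pp))) //.
  by rewrite leq_pexp2l // prime_gt0.
have S1 : \sum_(1 <= k < n.*2.+1) n.*2 %/ p ^ k = \sum_(1 <= k < t.+1) n.*2 %/ p ^ k.
  rewrite (@big_cat_nat _ _ _ t.+1) //= [X in _ + X]big_nat_cond [X in _ + X]big1 ?addn0 //.
  by move=> k /andP[/andP[tk _] _]; apply: big.
have S2 : \sum_(1 <= k < t.+1) n %/ p ^ k <= \sum_(1 <= k < n.+1) n %/ p ^ k.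
  have [tn'|nt] := leqP t n.
    by rewrite [X in _ <= X](@big_cat_nat _ _ _ t.+1) //= leq_addr.
  rewrite (@big_cat_nat _ _ _ n.+1) //=; last by lia.
  rewrite [X in _ + X]big_nat_cond [X in _ + X]big1 ?addn0 // => k /andP[/andP[nk _] _].
  by rewrite divn_small // (leq_trans nk) // ltnW // ltn_expl // prime_gt1.
have S3 : \sum_(1 <= k < t.+1) n.*2 %/ p ^ k <= t + (\sum_(1 <= k < t.+1) n %/ p ^ k).*2.
  have tE : \sum_(1 <= k < t.+1) 1 = t by rewrite sum_nat_const_nat subSS subn0 muln1.
  rewrite -[X in _ <= X + _]tE -[X in _ <= _ + X]muln2 big_distrl /= -big_split /=; apply: leq_sum => k _.
  rewrite -ltnS ltn_divLR ?expn_gt0 ?prime_gt0 //.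
  have := ltn_ceil n (_ : 0 < p ^ k); rewrite expn_gt0 prime_gt0 // => /(_ isT).
  move: (p ^ k) (n %/ p ^ k) => P u; nia.
by lia.
Qed.

Lemma prod_pfactors n b : 0 < n -> (forall p, prime p -> p %| n -> p <= b) ->
  n = \prod_(1 <= p < b.+1 | prime p) p ^ logn p n.
Proof.
move=> n0 nb; rewrite -{1}(partnT n0) (@widen_partn (maxn n b)) ?leq_maxl //.
rewrite big_ltn // lognE /= mul1n.
rewrite [RHS]big_mkcond [RHS]/= (@big_cat_nat _ _ _ b.+1) //=; last first.
  by rewrite ltnS leq_maxr.
rewrite [X in _ * X]big_nat_cond [X in _ * X]big1 ?muln1 => [|p /andP[/andP[bp _] _]].
  by apply: eq_bigr => p _; case: ifP => // pp; rewrite lognE pp.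
rewrite lognE n0 /=; case: (boolP (prime p)) => // pp /=.
by case: ifP => // /(nb _ pp); rewrite leqNgt bp.
Qed.

Lemma exp2_le_central_bin n : 2 ^ n <= 'C(n.*2, n).
Proof.
elim: n => // n IH; rewrite doubleS binS expnS.
have -> : 'C(n.*2.+1, n) = 'C(n.*2.+1, n.+1).
  by rewrite -bin_sub; [congr 'C(_, _) | ]; lia.
by rewrite addnn -mul2n leq_mul // binS (leq_trans IH) // leq_addl.
Qed.

Lemma prod_le_exp_size (s : seq nat) (F : nat -> nat) c :
  {in s, forall i, F i <= c} -> \prod_(i <- s) F i <= c ^ size s.
Proof.
elim: s => [|i s IH] H; first by rewrite big_nil.
rewrite big_cons expnS leq_mul ?H ?mem_head ?IH // => k ks.
by rewrite H // inE ks orbT.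
Qed.

(* Chebyshev: in the factorization of the central binomial coefficient of
   4^j, the primes up to 2^j contribute little because each prime power is
   at most 4^j, the primes between 2^j and 4^j/8 occur at most once and have
   a small product, so the primes above 4^j/8 must be numerous. *)
Lemma many_primes_pow4 j : 7 <= j ->
  4 ^ j <= 16 * j *
    size [seq q <- index_iota (2 ^ (j.*2 - 3)).+1 (4 ^ j).+1 | prime q].
Proof.
move=> j7; set B := 2 ^ _; set Q := filter _ _.
have XB : 4 ^ j = B * 8.
  by rewrite /B -[8]/(2 ^ 3) -expnD subnK; [rewrite -mul2n expnM | lia].
have B0 : 0 < B by rewrite expn_gt0.
set n := B * 4.
have n2 : n.*2 = 4 ^ j by rewrite XB /n; lia.
have sqX : 2 ^ j * 2 ^ j = 4 ^ j by rewrite -expnMn.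
(* This is where 7 comes from: 16 * 7 = 112 <= 128 = 2^7. *)
have j16 : 16 * j <= 2 ^ j.
  have -> : 2 ^ j = 2 ^ 7 * 2 ^ (j - 7) by rewrite -expnD subnKC.
  have : j - 7 < 2 ^ (j - 7) by rewrite ltn_expl.
  by rewrite -[2 ^ 7]/128; lia.
have jB : 2 ^ j <= B by nia.
have C0 : 0 < 'C(n.*2, n) by rewrite bin_gt0 -addnn leq_addr.
have n0 : 0 < n by rewrite /n; lia.
have pfle p : prime p -> p ^ logn p 'C(n.*2, n) <= 2 ^ j.*2.
  move=> pp; have -> : 2 ^ j.*2 = n.*2 by rewrite n2 -mul2n expnM.
  exact: pfactor_central_bin_le.
have := exp2_le_central_bin n.
rewrite {1}(@prod_pfactors _ n.*2 C0); last first.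
  move=> p pp pC; apply: leq_trans (pfactor_central_bin_le pp n0).
  rewrite -{1}[p]expn1 leq_pexp2l ?(prime_gt0 pp) //.
  by rewrite logn_gt0 mem_primes pp C0.
rewrite (@big_cat_nat _ _ _ (2 ^ j).+1) //=; last by lia.
rewrite [X in _ <= _ * X](@big_cat_nat _ _ _ B.+1) //=; last by lia.
set P1 := \prod_(1 <= p < _ | _) _.
set P2 := \prod_(_ <= p < B.+1 | _) _.
set P3 := \prod_(B.+1 <= p < _ | _) _.
have H1 : P1 <= (2 ^ j.*2) ^ (2 ^ j).
  rewrite /P1 -big_filter; set s := filter _ _.
  apply: (@leq_trans ((2 ^ j.*2) ^ size s)).
    apply: prod_le_exp_size => p.
    by rewrite mem_filter => /andP[pp _]; apply: pfle.
  rewrite leq_pexp2l ?expn_gt0 // size_filter (leq_trans (count_size _ _)) //.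
  by rewrite size_iota subSS subn0.
have H3 : P3 <= (2 ^ j.*2) ^ size Q.
  rewrite /Q -n2 /P3 -big_filter; apply: prod_le_exp_size.
  by move=> p; rewrite mem_filter => /andP[pp _]; apply: pfle.
have H2 : P2 <= 4 ^ B.
  apply: leq_trans (prod_primes_le_exp4 (j.*2 - 3)).
  rewrite [X in _ <= X](@big_cat_nat _ _ _ (2 ^ j).+1) //=.
  apply: leq_trans (leq_pmull _ _); last first.
    by rewrite prodn_cond_gt0 // => p /prime_gt0.
  rewrite /P2 big_nat_cond [X in _ <= X]big_nat_cond; apply: leq_prod => p.
  move=> /andP[/andP[jp pB] pp]; rewrite -[X in _ <= X]expn1 leq_pexp2l ?prime_gt0 //.
  (* Exponent at most 1: the prime power is at most 4^j, but p > 2^j gives p^2 > 4^j. *)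
  rewrite -ltnS -(@ltn_exp2l p) ?prime_gt1 //.
  apply: leq_ltn_trans (pfle p pp) _; rewrite -addnn expnD -mulnn.
  by rewrite ltn_mul.
move=> /leq_trans /(_ (leq_mul H1 (leq_mul H2 H3))).
rewrite -!expnM -[4]/(2 ^ 2) -expnM -!expnD leq_exp2l // => H.
(* The exponents of 2 give 4B <= 2j 2^j + 2B + 2j |Q|, and 2j 2^j <= B by [j16]; hence B <= 2j
   |Q|. *)
by rewrite XB; move: H; rewrite /n; nia.
Qed.

(** * An element free of small prime cubes *)

Lemma count_multiples_le d n k : 0 < d ->
  \sum_(1 <= i < k.+1) (d %| n + i) <= (k %/ d).+1.
Proof.
move=> d0.
have : \sum_(1 <= i < k.+1) (d %| n + i) + n %/ d = (n + k) %/ d.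
  elim: k => [|k IH]; first by rewrite big_geq // addn0.
  by rewrite big_nat_recr //= addnS divnS // -IH addnAC addnC.
have := leq_divDl d n k; lia.
Qed.

Lemma sum_div_cube_le k m : 0 < m ->
  2 * \sum_(2 <= p < m.+1) k %/ p ^ 3 <= k.
Proof.
move=> m0.
(* telescoping: 1/p^3 <= (1/2) (1/(p-1) - 1/p) *)
suff : 2 * m * \sum_(2 <= p < m.+1) k %/ p ^ 3 <= k * (m - 1).
  by move: (\sum_(2 <= p < m.+1) _) => S; nia.
case: m m0 => // m _; elim: m => [|m IH]; first by rewrite big_geq.
rewrite big_nat_recr //=.
move: IH; move: (\sum_(2 <= p < m.+2) _) => S.
have : k %/ m.+2 ^ 3 * m.+2 ^ 3 <= k by apply: leq_trunc_div.
move: (k %/ m.+2 ^ 3) => a; rewrite !subn1 /= => ha IH.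
rewrite -(@leq_pmul2l m.+1) //.
have h2 : a * (2 * (m.+1 * m.+2)) <= k.
  apply: leq_trans ha; rewrite leq_mul2l; apply/orP; right.
  by rewrite !expnS expn0; nia.
have h3 := leq_mul IH (leqnn m.+2).
by nia.
Qed.

(** Union bound over all integers 2 <= p <= k/4: the multiples of p^3 number at most k/p^3 + 1 each,
    in total at most k/2 + k/4 < k. *)
Lemma exists_cubefree_upto n k : 0 < k ->
  exists2 i, 0 < i <= k & forall p, prime p -> p <= k %/ 4 -> ~~ (p ^ 3 %| n + i).
Proof.
move=> k0; set y := k %/ 4.
have [y0|y0] := posnP y.
  by exists 1 => // p /prime_gt0; rewrite y0; case: p.
have [/hasP[i]|/hasPn H] := boolP
  (has (fun i => all (fun p => ~~ (p ^ 3 %| n + i)) (index_iota 2 y.+1)) (index_iota 1 k.+1)).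
  rewrite mem_index_iota => ik /allP H; exists i => // p pp py.
  by apply: H; rewrite mem_index_iota prime_gt1.
have : \sum_(1 <= i < k.+1) 1 <=
       \sum_(1 <= i < k.+1) \sum_(2 <= p < y.+1) (p ^ 3 %| n + i).
  rewrite big_seq [X in _ <= X]big_seq; apply: leq_sum => i ik.
  have /allPn[p py] := H i ik; rewrite negbK => pd.
  by rewrite (big_rem _ py) /= pd.
rewrite sum_nat_const_nat subSS subn0 muln1 exchange_big /=.
have : \sum_(2 <= p < y.+1) \sum_(1 <= i < k.+1) (p ^ 3 %| n + i)
    <= \sum_(2 <= p < y.+1) (k %/ p ^ 3 + 1).
  rewrite big_nat [X in _ <= X]big_nat; apply: leq_sum => p /andP[p2 _].
  by rewrite addn1 count_multiples_le // expn_gt0; case: p p2.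
rewrite big_split /= sum_nat_const_nat.
have := sum_div_cube_le k y0.
have : y * 4 <= k by apply: leq_trunc_div.
by lia.
Qed.

(** * The bound on runs in integer form *)

(** With X = 4^j this says X^3 <= 512 j log2 N, where j is of order log X. Only the primes q in
    (X/8, X] are used, so their sum is at least X/8 times their number. *)
Lemma equidivisor_run_bound N n k j :
  equidivisor_run n k -> n + k < N -> 7 <= j -> 2 ^ (4 ^ j) <= k ->
  2 ^ ((4 ^ j) ^ 3) <= N ^ (512 * j).
Proof.
move=> run nkN j7 Xk.
have k0 : 0 < k by apply: leq_trans Xk; rewrite expn_gt0.
have [i ik cf] := exists_cubefree_upto n k0.
have manyQ := many_primes_pow4 j7.
move: manyQ; set B := 2 ^ _; set Q := filter _ _ => manyQ.
have XB : 4 ^ j = B * 8.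
  by rewrite /B -[8]/(2 ^ 3) -expnD subnK; [rewrite -mul2n expnM | lia].
have B4 : 4 <= B by rewrite -[4]/(2 ^ 2) leq_pexp2l //; lia.
have inQ q : q \in Q -> [/\ prime q, B < q & q <= 4 ^ j].
  by rewrite mem_filter mem_index_iota ltnS => /and3P[].
have key : (k %/ 4) ^ (\sum_(q <- Q) q) <= (n + i) ^ 2.
  apply: exp_sum_le_sqr => //.
  - by rewrite filter_uniq // iota_uniq.
  - by move=> q /inQ [-> Bq _]; rewrite (leq_trans B4) // ltnW.
  - by lia.
  - move=> q /inQ [pq _ qX]; apply: dvdn_num_divisors_run run _ _ ik.
      exact: prime_gt0.
    by apply: leq_trans Xk; rewrite leq_pexp2l.
have sumQ : size Q * B <= \sum_(q <- Q) q.
  rewrite -sum1_size big_distrl /= big_seq [X in _ <= X]big_seq.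
  by apply: leq_sum => q /inQ[_ /ltnW]; rewrite mul1n.
have ygt : 2 ^ (4 ^ j - 2) <= k %/ 4.
  rewrite leq_divRL // (leq_trans _ Xk) // -[X in _ * X]/(2 ^ 2) -expnD subnK //.
  by lia.
move: XB sumQ manyQ key ygt; set X := 4 ^ j; set S := \sum_(q <- Q) q.
move: (size Q) => c XB sumQ manyQ key ygt.
have le1 : 2 ^ ((X - 2) * S) <= N ^ 2.
  rewrite expnM; apply: leq_trans (_ : (n + i) ^ 2 <= _); last first.
    by rewrite leq_exp2r //; lia.
  apply: leq_trans key.
  have [->|S0] := posnP S; first by rewrite !expn0.
  by rewrite leq_exp2r.
(* X <= 2(X-2), c X <= 8 S and X <= 16 j c combine to X^3 <= 256 j (X-2) S; [le1] supplies the last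
   factor 2. *)
have -> : 512 * j = 2 * (256 * j) by lia.
rewrite expnM; apply: leq_trans (_ : (2 ^ ((X - 2) * S)) ^ (256 * j) <= _); last first.
  by rewrite leq_exp2r //; lia.
rewrite -expnM leq_exp2l //.
have h1 : X <= 2 * (X - 2) by lia.
have h2 : c * X <= 8 * S by lia.
have h3 := leq_mul h1 h2.
have h4 : X * (X * X) <= X * X * (16 * j * c) by rewrite mulnA leq_mul2l manyQ orbT.
rewrite !expnS expn0 muln1 (leq_trans h4) //.
have h5 := leq_mul h3 (leqnn (16 * j)).
by lia.
Qed.

(** * Passage to natural logarithms *)

Import Order.TTheory GRing.Theory Num.Theory.
Local Open Scope ring_scope.

Lemma half_le_ln2 (R : realType) : (2^-1 : R) <= ln 2.
Proof.
rewrite -[leLHS]opprK -[in leRHS](invrK (2 : R)) lnV ?posrE ?invr_gt0 // lerN2.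
have := @le_ln1Dx R (- 2^-1).
by have -> : 1 + - 2^-1 = 2^-1 :> R; [lra | apply; lra].
Qed.

Lemma ln2_le1 (R : realType) : ln 2 <= (1 : R).
Proof. by apply: (@le_ln1Dx R 1); lra. Qed.

Lemma ln_nat_pow2 (R : realType) (a : nat) : ln ((2 ^ a)%:R : R) = a%:R * ln 2.
Proof. by rewrite natrX lnXn // mulr_natl. Qed.

Lemma ln_nat_le (R : realType) (a b : nat) :
  (0 < a)%N -> (a <= b)%N -> ln (a%:R : R) <= ln b%:R.
Proof.
by move=> a0 ab; rewrite ler_ln ?posrE ?ltr0n ?ler_nat // (leq_trans a0).
Qed.

Theorem theorem2 (R : realType) :
  exists (C : R) (N0 : nat), 0 < C /\
    forall N : nat, (2 <= N)%N -> (N0 <= N)%N ->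
      ln ((longest_run N)%:R : R) <=
        C * powR (ln (N%:R : R) * ln (ln (N%:R : R))) (3%:R^-1).
Proof.
have l2 := half_le_ln2 R; have l2' := ln2_le1 R.
(* N >= 2^8 and ln 2 >= 1/2 force ln N >= 4, so ln ln N >= 1. The constant 4^7 serves the case j <
   7; for larger j, 64 suffices. *)
exists (4 ^ 7)%:R, (2 ^ 8)%N; split; first by rewrite ltr0n.
move=> N N2 NN.
set k := longest_run N.
have [n [k0 nkN run]] := longest_run_attained N2.
rewrite -/k in k0 nkN run.
set LN := ln (N%:R : R); set LLN := ln LN.
have LN4 : 4 <= LN.
  have : ln ((2 ^ 8)%:R : R) <= LN by apply: ln_nat_le.
  by rewrite ln_nat_pow2; lra.
have LLN1 : 1 <= LLN.
  apply: (@le_trans _ _ (ln ((2 ^ 2)%:R : R))); first by rewrite ln_nat_pow2; lra.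
  by rewrite ler_ln ?posrE //; lra.
have A1 : 1 <= LN * LLN by nra.
set u := powR _ _.
have u3 : u ^+ 3 = LN * LLN.
  rewrite -powR_mulrn ?powR_ge0 // /u -powRrM mulVf ?pnatr_eq0 //.
  by rewrite powRr1 //; lra.
have u0 : 0 <= u by apply: powR_ge0.
have u1 : 1 <= u.
  by rewrite -(@ler_pXn2r _ 3) ?nnegrE // u3 expr1n.
(* Sandwich 4^j <= log2 k < 4^(j+1). The lower half needs a > 0, as [trunc_log 4 0] is 0; it is used
   only for j >= 7. *)
set a := trunc_log 2 k; set j := trunc_log 4 a.
have kX : (k <= 2 ^ (4 * 4 ^ j))%N.
  apply: ltnW; apply: leq_trans (@trunc_log_ltn 2 k isT) _.
  by rewrite leq_pexp2l // -expnS trunc_log_ltn.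
have ln1 : ln (k%:R : R) <= 4 * (4 ^ j)%:R * ln 2.
  by rewrite -natrM -ln_nat_pow2 ln_nat_le.
have [j7|j7] := ltnP j 7.
  have : 4 * (4 ^ j)%:R <= (4 ^ 7)%:R :> R.
    by rewrite -natrM ler_nat -expnS leq_pexp2l.
  have : 0 <= (4 ^ j)%:R :> R by rewrite ler0n.
  by move: ((4 ^ 7)%:R : R) ((4 ^ j)%:R : R) ln1 => c X lk X0 Xc; nra.
have a0 : (0 < a)%N by rewrite lt0n; apply/eqP => a0; rewrite /j a0 in j7.
have Xk : (2 ^ (4 ^ j) <= k)%N.
  apply: leq_trans (@trunc_logP 2 k isT k0); rewrite leq_pexp2l //.
  exact: trunc_logP.
have main := equidivisor_run_bound run nkN j7 Xk.
have kN : (k < N)%N by apply: leq_ltn_trans nkN; apply: leq_addl.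
have N0 : (0 < N)%N by apply: ltnW.
have lnX : (4 ^ j)%:R ^+ 3 * ln 2 <= 512 * j%:R * LN.
  have : ln ((2 ^ (4 ^ j) ^ 3)%:R : R) <= ln (N ^ (512 * j))%:R.
    by apply: ln_nat_le => //; rewrite expn_gt0.
  rewrite ln_nat_pow2 [in leRHS]natrX lnXn ?ltr0n // -[leRHS]mulr_natl.
  by rewrite (natrM R 512 j) (natrX R (4 ^ j) 3).
(* 4^j ln 2 <= ln N and ln 2 >= 1/2 give 2^(2j-1) <= ln N; taking logarithms again, j - 1/2 <= ln ln
   N. *)
have jLL : j%:R <= 2 * LLN.
  have h1 : ln ((2 ^ (j.*2 - 1))%:R : R) <= LLN.
    rewrite ler_ln ?posrE ?ltr0n ?expn_gt0 //; last by lra.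
    have h : ln ((2 ^ (4 ^ j))%:R : R) <= LN.
      by apply: ln_nat_le; rewrite ?expn_gt0 // ltnW // (leq_ltn_trans Xk).
    apply: le_trans h; rewrite ln_nat_pow2.
    have -> : (4 ^ j = 2 * 2 ^ (j.*2 - 1))%N.
      by rewrite -expnS -(expnM 2 2) mul2n; congr (_ ^ _)%N; lia.
    rewrite natrM; have : 0 <= (2 ^ (j.*2 - 1))%:R :> R by rewrite ler0n.
    by nra.
  rewrite ln_nat_pow2 natrB in h1; last by lia.
  rewrite -muln2 natrM in h1.
  have : (7%:R : R) <= j%:R by rewrite ler_nat.
  by nra.
move: ((4 ^ j)%:R : R) (j%:R : R) (ler0n R (4 ^ j)) ln1 lnX jLL => X J X0 lk lnX jLL.
(* [lnX] and [jLL] give X^3 <= 2048 u^3, rounded up to the cube 4096 = 16^3. *)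
have X16u : X <= 16 * u.
  rewrite -(@ler_pXn2r _ 3) ?nnegrE ?mulr_ge0 //.
  have -> : (16 * u) ^+ 3 = 4096 * u ^+ 3 by rewrite exprMn -natrX.
  have v0 : 0 <= X ^+ 3 by rewrite exprn_ge0.
  by rewrite u3; nra.
apply: (@le_trans _ _ (64 * u)); first by nra.
by rewrite ler_wpM2r // ler_nat.
Qed.
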